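(* Let $K,i,\kappa$ be positive integers and $\epsilon\in\{0,1\}$ such that $K>2$, $K=2\kappa-\epsilon$ and $1\le i\le\kappa$. Then for all integers $n,m\ge 0$, $$J_{K,i}(n,m)=P_{K,i}(2n,m),$$ where $J_{K,i}(n,m)$ is the number of $K$-restricted jagged partitions $(n_1,\dots,n_m)$ of length $m$ with $\sum_j n_j=n$ containing at most $i-1$ pairs $01$, and $P_{K,i}(2n,m)$ is the number of lattice paths of weight $2n$ and charge $m$ that start at $(0,2\kappa-2i)$, have all peaks of height not larger than $K-1$, and have all peaks at even $x$ positions.
   Context: **Jagged partitions.** A jagged partition of length $m$ is a sequence of non-negative integers $(n_1,\dots,n_m)$ with $n_j\ge n_{j+1}-1$ (for $1\le j\le m-1$), $n_j\ge n_{j+2}$ (for $1\le j\le m-2$), and $n_m\ge 1$. For $m=0$ the only one is the empty sequence. It is $K$-restricted if for every $1\le j\le m-K+1$ either $$n_j\ge n_{j+K-1}+1\qquad\text{or}\qquad n_j=n_{j+1}-1=n_{j+K-2}+1=n_{j+K-1}.$$ A pair $01$ is an index $j$ with $(n_j,n_{j+1})=(0,1)$. **Lattice paths.** Paths are in the first quadrant of the integer square lattice. A path starts at a point $(0,a)$ with $a$ an even non-negative integer. The allowed steps are: from $(x,y)$ to $(x+1,y+1)$; from $(x,y)$ to $(x+1,y-1)$ if $y\ge1$; and from $(x,0)$ to $(x+1,0)$. A non-empty path ends on the $x$ axis with a step from $(x,1)$ to $(x+1,0)$; the empty path (no steps) is allowed only for $a=0$. A peak is a vertex preceded by a step $(+1,+1)$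 and followed by a step $(+1,-1)$ (the starting vertex is never a peak); the height of a peak is its $y$ coordinate. The weight of a path is the sum of the $x$ coordinates of all its peaks. The relative height of a peak at $(x,y)$ is the largest integer $h$ such that there are two vertices $(x',y-h)$ and $(x'',y-h)$ on the path with $x'<x<x''$ such that between these two vertices there are no peaks of height larger than $y$ and every other peak of height equal to $y$ between them has $x$ coordinate larger than $x$. The charge of a path is the sum of the relative heights of all its peaks. *)

(* Defs.v *)
From mathcomp Require Import all_boot finmap.
From mathcomp Require Import boolp classical_sets functions cardinality.
From mathcomp Require Import zify.

Set Implicit Arguments.
Unset Strict Implicit.
Unset Printing Implicit Defensive.

Local Open Scope nat_scope.
Local Open Scope classical_set_scope.

(* Number of elements of A; it is only meaningful for finite A (it is 0      *)
(* otherwise), see jagged_set_finite and path_set_finite below.              *)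
Definition ncard (T : choiceType) (A : set T) : nat := #|` fset_set A|.

(* Sequences are indexed from 0, so n_j is nth 0 s j.-1.                     *)

Definition jagged (s : seq nat) : Prop :=
  [/\ forall j, j.+1 < size s -> nth 0 s j.+1 <= (nth 0 s j).+1,
      forall j, j.+2 < size s -> nth 0 s j.+2 <= nth 0 s j
    & s <> [::] -> 1 <= last 0 s].

(* The equalities are written without truncated subtraction.                 *)
Definition restricted (K : nat) (s : seq nat) : Prop :=
  forall j, j + (K - 1) < size s ->
    nth 0 s (j + (K - 1)) + 1 <= nth 0 s j \/
    [/\ nth 0 s j.+1 = nth 0 s j + 1,
        nth 0 s j = nth 0 s (j + (K - 2)) + 1
      & nth 0 s j = nth 0 s (j + (K - 1))].

Definition pairs01 (s : seq nat) : nat :=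
  #|[set j : 'I_(size s) | (j.+1 < size s) &&
       ((nth 0 s j == 0) && (nth 0 s j.+1 == 1))]%SET|.

Definition jagged_set (K i n m : nat) : set (seq nat) :=
  [set s | [/\ jagged s, size s = m & sumn s = n] /\
           (restricted K s /\ pairs01 s <= i - 1)].

Definition jagged_number (K i n m : nat) : nat := ncard (jagged_set K i n m).

(* A path is encoded by the sequence s of the heights of its vertices: the   *)
(* vertex of abscissa x is (x, nth 0 s x), for x < size s. The empty path    *)
(* (no steps) is the one-vertex sequence [:: 0].                             *)

Definition lattice_step : rel nat :=
  fun y z => [|| z == y.+1, y == z.+1 | (y == 0) && (z == 0)].

Definition lattice_path (s : seq nat) : Prop :=
  [/\ ~~ odd (nth 0 s 0), sorted lattice_step s
    & s = [:: 0] \/ exists t, s = rcons (rcons t 1) 0].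

Definition peak (s : seq nat) (x : nat) : bool :=
  [&& 0 < x, x.+1 < size s,
      nth 0 s x == (nth 0 s x.-1).+1 & nth 0 s x == (nth 0 s x.+1).+1].

Definition weight (s : seq nat) : nat := \sum_(x < size s | peak s x) x.

Definition spans (s : seq nat) (x h : nat) : bool :=
  [exists l : 'I_(size s), exists r : 'I_(size s),
    [&& l < x < r, nth 0 s l == nth 0 s x - h, nth 0 s r == nth 0 s x - h
      & [forall z : 'I_(size s), (l < z < r) && peak s z ==>
          (nth 0 s z <= nth 0 s x) &&
          ((z != x :> nat) && (nth 0 s z == nth 0 s x) ==> (x < z))]]].

(* Since heights are nonnegative h cannot exceed the height of the peak, and *)
(* h = 1 is always admissible for a peak (peak_spans1), so that the largest  *)
(* integer h is the largest one between 0 and the height.                    *)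
Definition relative_height (s : seq nat) (x : nat) : nat :=
  \max_(h < (nth 0 s x).+1 | spans s x h) h.

Definition charge (s : seq nat) : nat :=
  \sum_(x < size s | peak s x) relative_height s x.

Definition path_set (K kappa i w m : nat) : set (seq nat) :=
  [set s | [/\ lattice_path s, nth 0 s 0 = 2 * kappa - 2 * i,
               weight s = w & charge s = m] /\
           forall x, peak s x -> nth 0 s x <= K - 1 /\ ~~ odd x].

Definition path_number (K kappa i w m : nat) : nat := ncard (path_set K kappa i w m).

Lemma peak_spans1 (s : seq nat) (x : nat) : peak s x -> spans s x 1.
Proof.
case/and4P=> x0 xs /eqP up /eqP down.
have xs1 : x.-1 < size s by lia.
apply/existsP; exists (Ordinal xs1); apply/existsP; exists (Ordinal xs) => /=.
apply/and4P; split; [lia|lia|lia|].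
apply/forallP => z; apply/implyP => /andP[zx _].
by have -> : z = x :> nat; [lia|rewrite leqnn eqxx].
Qed.

Lemma bounded_seq_finite (B C : nat) :
  finite_set [set s : seq nat | size s <= B /\ forall x, nth 0 s x <= C].
Proof.
pose f (p : 'I_B.+1 * {ffun 'I_B.+1 -> 'I_C.+1}) : seq nat :=
  mkseq (fun x => p.2 (inord x) : nat) p.1.
apply: (@sub_finite_set _ _ (f @` setT)); last exact/finite_image/finite_finset.
move=> s /= [sB sC].
exists (inord (size s), [ffun x : 'I_B.+1 => inord (nth 0 s x)]) => //.
rewrite /f /= inordK ?ltnS//; apply: (@eq_from_nth _ 0); rewrite size_mkseq// => x xs.
by rewrite nth_mkseq// ffunE !inordK ?ltnS// (leq_trans _ sB)// ltnW.
Qed.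

Lemma jagged_set_finite (K i n m : nat) : finite_set (jagged_set K i n m).
Proof.
apply: sub_finite_set (bounded_seq_finite m n) => s /= [[_ -> <-] _].
split=> // x; elim: s x => [|a s IHs] [|x] //=; first exact: leq_addr.
exact: leq_trans (IHs x) (leq_addl _ _).
Qed.

Lemma lattice_path_nth (s : seq nat) : lattice_path s ->
  forall x, x.+1 < size s -> lattice_step (nth 0 s x) (nth 0 s x.+1).
Proof. by case=> _ /(sortedP 0). Qed.

Lemma lattice_path_height (s : seq nat) : lattice_path s ->
  forall x, nth 0 s x <= nth 0 s 0 + x.
Proof.
move=> ps; elim=> [|x IHx]; first by rewrite addn0.
have [xs|sx] := ltnP x.+1 (size s); last by rewrite nth_default.
by have := lattice_path_nth ps xs; rewrite /lattice_step; lia.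
Qed.

Lemma peak_le_weight (s : seq nat) (x : nat) : peak s x -> x <= weight s.
Proof.
move=> px; have xs : x < size s by case/and4P: px => _ /ltnW.
by rewrite /weight (bigD1 (Ordinal xs)) //= leq_addr.
Qed.

Lemma lattice_path_size (s : seq nat) : lattice_path s ->
  size s <= (2 * weight s + nth 0 s 0).+1.
Proof.
move=> ps.
have [L sL] : exists L, size s = L.+1.
  by case: ps => _ _ [->|[t ->]]; [exists 0 | exists (size t).+1; rewrite !size_rcons].
have s0 : nth 0 s L = 0.
  have -> : L = (size s).-1 by rewrite sL.
  by rewrite nth_last; case: ps => _ _ [->|[t ->]]; rewrite ?last_rcons.
suff H j : j <= L -> (forall t, j <= t <= L -> nth 0 s t + t = L) ->
    L <= 2 * weight s + nth 0 s 0.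
  by rewrite sL ltnS; apply: (H L) => // t tL; have -> : t = L; [lia|rewrite s0].
elim: j => [|j IHj] jL Hj; first by have := Hj 0 isT; lia.
have step := lattice_path_nth ps (x := j); rewrite sL ltnS in step.
move/(_ jL): step; rewrite /lattice_step; have Hj1 := Hj j.+1; have := Hj1.
rewrite leqnn jL => /(_ isT) {}Hj1.
case/or3P => [/eqP up|/eqP down|/andP[/eqP flat0 /eqP flat]].
- have pj : peak s j.+1.
    have jL' : j.+2 <= L by lia.
    have Hj2 := Hj j.+2; rewrite jL' leqnSn in Hj2; move: (Hj2 isT) => {}Hj2.
    rewrite /peak sL /= up eqxx /=; apply/andP; split; lia.
  by have := peak_le_weight pj; have := lattice_path_height ps j.+1; lia.
- apply: IHj; first lia.
  move=> t tL; have [->|tj] := eqVneq t j; first lia.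
  by apply: Hj; lia.
- have Lj : L = j.+1 by lia.
  case: ps => _ _ [E|[t E]]; first by move: sL; rewrite E /=; lia.
  move: sL flat0; rewrite E !size_rcons Lj => -[<-].
  by rewrite !nth_rcons !size_rcons ltnS leqnn ltnn eqxx.
Qed.

Lemma path_set_finite (K kappa i w m : nat) :
  finite_set (path_set K kappa i w m).
Proof.
pose a := 2 * kappa - 2 * i.
apply: sub_finite_set (bounded_seq_finite (2 * w + a).+1 (a + (2 * w + a).+1)).
move=> s /= [[ps sa sw _] _].
have := lattice_path_size ps; rewrite sw sa -/a => sB; split=> // x.
have [xs|sx] := ltnP x (size s); last by rewrite nth_default.
have := lattice_path_height ps x; rewrite sa -/a; lia.
Qed.

(* Main.v *)
Require Import Defs.
From mathcomp Require Import all_boot finmap.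
From mathcomp Require Import boolp classical_sets cardinality.
From mathcomp Require Import zify.

Local Open Scope nat_scope.

Set Implicit Arguments.
Unset Strict Implicit.

(* Both sides count the frequency sequences [f_1, f_2, ...] such that        *)
(* [f_j] is even for odd [j], [f_j + f_(j+1) <= K - 1] for [j >= 0] with     *)
(* [f_0 := 2 kappa - 2 i], [sum_j j f_j = 2 n] and [sum_j f_j = m].          *)
(*                                                                           *)
(* On the jagged side, replace each ascent [r, r+1] by two parts [2r+1] and  *)
(* each remaining entry [r] by a part [2r]; this gives a partition, and      *)
(* [f_j] is the multiplicity of [j] in it.                                   *)
(*                                                                           *)
(* On the path side, the charge is simply the number of up steps: send an    *)
(* up step to the leftmost highest vertex of the excursion that it opens;    *)
(* exactly [h] up steps are sent to a peak of relative height [h]. With this *)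
(* local description the Burge correspondence applies: [f_0] is the height   *)
(* of the initial vertex, removing the first step of the path amounts to     *)
(* [(f_j, f_(j+1)) -> (f_j + 1, f_(j+1) - 1)] on a system of disjoint pairs  *)
(* [(j, j+1)], and there are as many pairs as peaks. Adding two steps other  *)
(* than an up step followed by a down step preserves the parity of [f_j] for *)
(* odd [j], so that having only peaks of even abscissa means that these      *)
(* [f_j] are even.                                                           *)

(** A path is determined by its starting height and by which of its steps are up, and [burge]
    absorbs these steps from the last to the first. Since [lead] recovers the absorbed step and
    [burge] can be inverted on trimmed sequences ([burge_inj], [burge_surj]), paths from a given
    height correspond to trimmed sequences ([path_freq_inj], [path_freq_surj]). The statistics are
    matched by [weight_path_freq], [charge_path_freq], [adjacent_le_path_freq] and
    [even_peaks_path_freq]. On the jagged side the crux is [restricted_parts]: being restricted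
    means that parts [K - 1] places apart differ by at least 2, which [parts_difference] turns into
    the bound on [f_j + f_(j+1)]. As [f_1] is twice the number of pairs 01, the bound on [f_0 + f_1]
    limits these pairs. Both images are [freq_set]. *)

(** * The Burge transformation *)

(* A frequency sequence is the list [:: f_1; f_2; ...]. This is the inverse  *)
(* transformation [(f_j, f_(j+1)) -> (f_j - 1, f_(j+1) + 1)], the pairs      *)
(* being chosen greedily from the left among the [j] with [f_j > 0]; [up]    *)
(* means that the pair (0, 1) is chosen, i.e. that the prepended step is up. *)
Fixpoint burge (up : bool) (f : seq nat) : seq nat :=
  match f, up with
  | [::], false => [::]
  | [::], true => [:: 1]
  | a :: g, true => a.+1 :: burge false g
  | a :: g, false => a.-1 :: burge (0 < a) g
  end.

(* Whether (0, 1) is a pair when the pairs (j, j+1) with [f_(j+1) > 0] are   *)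
(* chosen greedily from the right.                                           *)
Fixpoint lead (f : seq nat) : bool :=
  if f is a :: g then (0 < a) && ~~ lead g else false.

Fixpoint npairs (f : seq nat) : nat :=
  if f is _ :: g then lead f + npairs g else 0.

(** Summing the suffix sums counts [f_j] exactly [j] times. *)
Fixpoint freq_weight (f : seq nat) : nat :=
  if f is _ :: g then sumn f + freq_weight g else 0.

(** The default 1 makes the empty sequence trimmed. *)
Definition trimmed (f : seq nat) : bool := last 1 f != 0.

Fixpoint adjacent_le (M : nat) (f : seq nat) : bool :=
  if f is a :: g then (a + nth 0 g 0 <= M) && adjacent_le M g else true.

Fixpoint alternate_even (p : bool) (f : seq nat) : bool :=
  if f is a :: g then (p ==> ~~ odd a) && alternate_even (~~ p) g else true.

Lemma lead_burge u f : lead (burge u f) = u.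
Proof. by elim: f u => [|a f IHf] [] //=; rewrite IHf // andbC; case: a. Qed.

Lemma trimmed_behead a f : trimmed (a :: f) -> trimmed f.
Proof. by case: f. Qed.

Lemma trimmed_burge u f : trimmed f -> trimmed (burge u f).
Proof.
elim: f u => [|a f IHf] [] // cf; have := IHf _ (trimmed_behead cf).
  by move/(_ false); rewrite /trimmed /=; case: (burge _ f).
case: a cf => [|a] cf; last by move/(_ true); rewrite /trimmed /=; case: f {IHf cf}.
move/(_ false); rewrite /trimmed /=; case: f cf {IHf} => [|b f] //.
Qed.

Lemma burge_false_nil f : burge false f = [::] -> f = [::].
Proof. by case: f. Qed.

Lemma burge_inj u f g : trimmed f -> trimmed g ->
  burge u f = burge u g -> f = g.
Proof.
elim: f g u => [|a f IHf] [|b g] [] //= cf cg.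
- by case=> b0 /esym/burge_false_nil g0; move: cg; rewrite g0 -b0.
- by case=> b0 /burge_false_nil g0; move: cf; rewrite g0 b0.
- by case=> -> /IHf ->; [| exact: trimmed_behead cf | exact: trimmed_behead cg].
(* The truncated predecessor confuses the heads 0 and 1; the [lead] of the tail, which is [0 < a],
   separates them. *)
- case=> ab fg; have := congr1 lead fg; rewrite !lead_burge => ab0.
  rewrite -ab0 in fg; have -> : a = b by move: ab ab0; case: (a) (b) => [|?] [|?] //= ->.
  by rewrite (IHf _ _ _ _ fg) //; [exact: trimmed_behead cf | exact: trimmed_behead cg].
Qed.

Lemma burge_surj f : trimmed f ->
  exists2 g, trimmed g & f = burge (lead f) g.
Proof.
elim: f => [|a f IHf] cf; first by exists [::].
have [g cg fg] := IHf (trimmed_behead cf).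
rewrite [lead _]/=; case lf: (lead f) in fg *.
  exists (a.+1 :: g); first by case: g cg {fg}.
  by rewrite andbF /= fg.
case: a cf => [|a] cf /=.
  exists (0 :: g); last by rewrite /= -fg.
  by case: g cg fg => // _ f0; rewrite f0 in cf.
(* With an empty tail, [a :: g] could be [[:: 0]], which is not trimmed; [[:: 1]] comes from the
   empty sequence instead. *)
have [/eqP/nilP g0|g0] := eqVneq (size g) 0; last first.
  exists (a :: g); last by rewrite /= -fg.
  by case: g cg g0 {fg}.
rewrite g0 /= in fg; rewrite fg; case: a {cf} => [|a]; first by exists [::].
by exists [:: a.+1].
Qed.

Lemma sumn_burge u f : sumn (burge u f) = sumn f + u.
Proof. by elim: f u => [|[|a] f IHf] [] //=; rewrite IHf; lia. Qed.

Lemma npairs_burge u f : npairs (burge u f) = npairs f + (u && ~~ lead f).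
Proof.
elim: f u => [|a f IHf] [] //=; rewrite lead_burge IHf /=; last by case: a => //=; lia.
by case: (_ && _) => /=; lia.
Qed.

(** Each pair moves one unit from [f_j] to [f_(j+1)] and so adds 1 to the weight, also for [j = 0]
    since [f_0] has weight 0. *)
Lemma freq_weight_burge u f :
  freq_weight (burge u f) = freq_weight f + npairs (burge u f).
Proof.
by elim: f u => [|a f IHf] [] //=; rewrite sumn_burge lead_burge IHf /=; case: a => /=; lia.
Qed.

Lemma npairs_gt0 f : trimmed f -> f != [::] -> 0 < npairs f.
Proof.
elim: f => //= a [|b f] IHf cf _; first by case: a cf.
by have := IHf (trimmed_behead cf) isT; lia.
Qed.

(** The sum over a pair is unchanged. Another sum [f_j + f_(j+1)] grows only if [f_(j+1) = 0] and
    [(j-1, j)] is a pair, whose sum bounds the new value; for [j = 0] the conjunct [a <= M] does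
    this. It shrinks only if [f_j = 0] and [(j+1, j+2)] is a pair, whose sum bounds the old
    value. *)
Lemma adjacent_le_burge M a u f :
  adjacent_le M (a :: burge u f) =
  (a <= M) && adjacent_le M ((if u then a.+1 else a.-1) :: f).
Proof.
elim: f a u => [|b f IHf] a [].
- by rewrite /=; lia.
- by rewrite /=; lia.
- have := IHf b.+1 false; rewrite /= => ->; move: (adjacent_le _ _) => A; lia.
- by have := IHf b.-1 (0 < b); case: b => [|b]; rewrite /= => ->; move: (adjacent_le _ _) => A; lia.
Qed.

Lemma adjacent_leP M f :
  reflect (forall j, nth 0 f j + nth 0 f j.+1 <= M) (adjacent_le M f).
Proof.
elim: f => [|a f IHf] /=; first by constructor => j; rewrite !nth_nil.
apply: (iffP andP) => [[af /IHf fM] [|j] //= | H]; split; first exact: (H 0).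
by apply/IHf => j; exact: (H j.+1).
Qed.

Lemma alternate_evenP p f :
  reflect (forall j, odd j != p -> ~~ odd (nth 0 f j)) (alternate_even p f).
Proof.
elim: f p => [|a f IHf] p /=; first by constructor => j; rewrite nth_nil.
apply: (iffP andP) => [[/implyP af /IHf ef] [|j] /= jp | H].
- by apply: af; move: jp {ef}; case: p.
- by apply: ef; move: jp {af}; case: (odd j); case: p.
split; first by apply/implyP => pt; apply: (H 0); rewrite pt.
by apply/IHf => j jp; apply: (H j.+1); move: jp {H} => /=; case: (odd j); case: p.
Qed.

(** In the excluded case the two steps leave the head alone and pass to the tail in the opposite
    order, while [p] flips, until a constrained entry goes from 0 to 1. *)
Lemma alternate_even_burge2 p u v f :
  alternate_even p (burge u (burge v f)) =
  alternate_even p f && ((u == v) || (u != p)).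
Proof.
elim: f p u v => [|a f IHf] p u v; first by case: p u v => -[] [].
by case: u; case: v; case: a => [|[|a]]; rewrite /= !IHf /= ?negbK;
  case: p; rewrite /= ?andbT ?andbF ?negbK.
Qed.

(** * From lattice paths to frequency sequences *)

Fixpoint path_freq (s : seq nat) : seq nat :=
  match s with
  | a :: (b :: _) as t => burge (a < b) (path_freq t)
  | _ => [::]
  end.

(** The parity of the starting height is left out so that tails of paths are again paths. *)
Fixpoint is_path (s : seq nat) : bool :=
  match s with
  | [::] => false
  | [:: a] => a == 0
  | a :: (b :: t') as t => [&& lattice_step a b, is_path t & (t' == [::]) ==> (a == 1)]
  end.

Lemma lattice_stepE a b : lattice_step a b = (b == if a < b then a.+1 else a.-1).
Proof. by rewrite /lattice_step; case: ltnP; lia. Qed.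

Lemma is_pathP s : lattice_path s <-> ~~ odd (nth 0 s 0) /\ is_path s.
Proof.
suff H : is_path s <-> sorted lattice_step s /\
    (s = [:: 0] \/ exists t, s = rcons (rcons t 1) 0).
  by split=> [[s0 ss /(conj ss)/H]|[s0 /H[]]].
elim: s => [|a [|b s] IHs].
- by split=> // -[_ [//|[[|? ?] //]]].
- by split=> [/eqP->|[_ [[->]|[[|x [|? ?]] //]]]]; split=> //; left.
rewrite [is_path _]/= [sorted _ _]/=; split.
  case/and3P => ab /IHs[bs ends] /implyP a1; split; first by rewrite ab.
  case: ends => [[b0 s0]|[t ->]]; last by right; exists (a :: t).
  by right; exists [::]; rewrite b0 s0 (eqP (a1 _)) // s0.
case=> /andP[ab bs] [//|[t E]]; rewrite ab; case: t E => [|c t] [-> E].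
  by case: E => -> ->.
case: s E bs IHs => [|c' s] E bs IHs; first by case: t E => [|? [|? ?]].
by rewrite andbT; apply/IHs; split=> //; right; exists t.
Qed.

Lemma trimmed_path_freq s : trimmed (path_freq s).
Proof. by elim: s => [|a [|b s] IHs] //; exact: trimmed_burge IHs. Qed.

(** The path must climb before its last step, which leaves height 1, and [burge] never empties a
    sequence. *)
Lemma path_freq_neq_nil a s : is_path (0 :: a :: s) -> path_freq (0 :: a :: s) != [::].
Proof.
elim: s a => [|b s IHs] a; first by case/and3P => _ /eqP->.
case/and3P => _ ps _; rewrite [path_freq _]/= -/(path_freq (a :: b :: s)).
case: (posnP a) ps => [-> /IHs | a0 _]; last by case: (path_freq _).
by apply: contraNneq => /burge_false_nil/eqP.
Qed.

Lemma path_freq_inj s s' : is_path s -> is_path s' ->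
  nth 0 s 0 = nth 0 s' 0 -> path_freq s = path_freq s' -> s = s'.
Proof.
elim: s s' => // a [|b s] IHs [//|a' [|b' s']] ps ps' /= aa'; rewrite -?aa'.
- by [].
- by move: ps ps' => /eqP a0; rewrite -aa' a0 => /path_freq_neq_nil/eqP/= H /esym/H.
- by move: ps' ps => /eqP a0; rewrite aa' a0 => /path_freq_neq_nil/eqP/= H /H.
move=> E; have := congr1 lead E; rewrite !lead_burge => bb'.
have bE : b = b'.
  move: ps ps' => /and3P[+ _ _] /and3P[+ _ _].
  by rewrite !lattice_stepE -aa' -bb' => /eqP bE /eqP->.
rewrite -bb' in E; have {}E : path_freq (b :: s) = path_freq (b' :: s').
  exact: (@burge_inj (a < b) (path_freq (b :: s)) (path_freq (b' :: s'))
            (trimmed_path_freq _) (trimmed_path_freq _) E).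
rewrite (IHs (b' :: s')) //.
- by case/and3P: ps.
- by case/and3P: ps'.
Qed.

(** Induction on the weight: undoing one [burge] lowers it by the number of pairs, positive unless
    [f] is empty. The empty sequence encodes the straight descent. *)
Lemma path_freq_surj f a : trimmed f ->
  exists s, [/\ is_path s, nth 0 s 0 = a & path_freq s = f].
Proof.
have [w] := ubnP (freq_weight f); elim: w f a => // w IHw f a fw cf.
have [-> {f fw cf}|f0] := eqVneq f [::].
  elim: a => [|a [[|b s] [// ps sa sf]]]; first by exists [:: 0].
  rewrite /= in sa; exists [:: a.+1, b & s]; split=> //.
  - rewrite [is_path _]/= -/(is_path (b :: s)) ps sa /lattice_step eqxx orbT /=.
    by case: s ps {sf} => //= /eqP<-; rewrite sa.
  - by rewrite [LHS]/= -/(path_freq (b :: s)) sf sa ltnNge leqnSn.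
have [g cg fE] := burge_surj cf.
have gf : freq_weight g < freq_weight f.
  by rewrite fE freq_weight_burge -fE; have := npairs_gt0 cf f0; lia.
have [|s [ps sa sg]] := IHw g (if lead f then a.+1 else a.-1) _ cg; first lia.
exists (a :: s); case: s ps sa sg => // b s ps sa sg; rewrite /= in sa.
have ab : (a < b) = lead f by rewrite sa; case: ifP => _; lia.
split=> //; last by rewrite [LHS]/= -/(path_freq (b :: s)) sg ab -fE.
rewrite [is_path _]/= -/(is_path (b :: s)) ps lattice_stepE ab -sa eqxx /=.
(* The rest of the path is not a single vertex: its height 0 would make [lead f] false, and then [f]
   would be empty. *)
apply/implyP => /eqP s0; move: ps sg sa; rewrite s0 => /= /eqP-> g0.
by move: f0; rewrite {1}fE -g0; case: (lead f).
Qed.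

Lemma adjacent_le_path_freq M a s : is_path (a :: s) ->
  adjacent_le M (a :: path_freq (a :: s)) = all (leq^~ M) (a :: s).
Proof.
elim: s a => [|b s IHs] a; first by rewrite /= addn0.
case/and3P => ab ps _; rewrite [path_freq _]/= -/(path_freq (b :: s)) adjacent_le_burge.
by rewrite -(eqP (etrans (esym (lattice_stepE a b)) ab)) IHs.
Qed.

Lemma peak0 s : peak s 0 = false. Proof. by []. Qed.

Lemma peak_cons1 a b s : is_path [:: a, b & s] ->
  peak [:: a, b & s] 1 = (a < b) && ~~ lead (path_freq (b :: s)).
Proof.
case/and3P => ab + _; rewrite /peak /= ltnS; case: s => [/eqP->//|c s].
case/and3P => bc _ _; rewrite [path_freq _]/= lead_burge /=.
by move: ab bc; rewrite /lattice_step; lia.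
Qed.

Lemma sum_peak_cons a b s (F : nat -> nat) :
  \sum_(x < size [:: a, b & s] | peak [:: a, b & s] x) F x =
  (if peak [:: a, b & s] 1 then F 1 else 0) +
  \sum_(x < size (b :: s) | peak (b :: s) x) F x.+1.
Proof.
rewrite !big_mkcond /= [in RHS]big_mkcond !big_ord_recl !peak0 /= !add0n.
by congr (_ + _); apply: eq_bigr.
Qed.

Lemma npairs_path_freq s : is_path s ->
  \sum_(x < size s | peak s x) 1 = npairs (path_freq s).
Proof.
elim: s => // a [|b s] IHs ps; first by rewrite /= big_mkcond big_ord1.
rewrite (sum_peak_cons _ _ _ (fun=> 1)) peak_cons1 // IHs; last by case/and3P: ps.
by rewrite [path_freq (a :: _)]/= npairs_burge addnC; case: (_ && _).
Qed.

Lemma weight_path_freq s : is_path s -> weight s = freq_weight (path_freq s).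
Proof.
rewrite /weight; elim: s => // a [|b s] IHs ps; first by rewrite /= big_mkcond big_ord1.
have psb : is_path (b :: s) by case/and3P: ps.
rewrite (sum_peak_cons _ _ _ id) [path_freq (a :: _)]/=.
rewrite -/(path_freq (b :: s)) freq_weight_burge -IHs //.
under eq_bigr do rewrite -addn1.
rewrite big_split [X in _ + (_ + X)]npairs_path_freq // peak_cons1 // npairs_burge.
by case: (_ && _) => /=; lia.
Qed.

(** Removing two steps at a time keeps the parity of the remaining abscissas, and a peak at abscissa
    1 is the case excluded by [alternate_even_burge2]. *)
Lemma even_peaks_path_freq s : is_path s ->
  (forall x, peak s x -> ~~ odd x) <-> alternate_even true (path_freq s).
Proof.
have [n] := ubnP (size s); elim: n s => // n IHn [//|a [|b [|c s]]] sn ps.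
- by split=> // _ [|[|x]].
- by case/and3P: ps => _ /eqP -> _; split=> // _ [|[|x]].
have psb : is_path [:: b, c & s] by case/and3P: ps.
have psc : is_path (c :: s) by case/and3P: psb.
rewrite [path_freq _]/= -/(path_freq (c :: s)) alternate_even_burge2.
have /IHn - /(_ psc) [IH1 IH2] : size (c :: s) < n by rewrite /= in sn *; lia.
have p1 := peak_cons1 ps; rewrite [path_freq _]/= lead_burge in p1.
split=> [H|/andP[/IH2 H abc] [|[|[|x]]] //].
- apply/andP; split; first by apply: IH1 => -[|x] // px; have := H x.+3 px; rewrite /= !negbK.
  by have := H 1; rewrite p1; case: (a < b); case: (b < c) => //= /(_ isT).
- by rewrite p1 => /andP[ab /negbTE bc]; rewrite ab bc in abc.
- by move=> /(H x.+1); rewrite /= !negbK.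
Qed.

(** * The charge is the number of up steps *)

Lemma leftmost_max (F : nat -> nat) l r : l < r ->
  exists x, [/\ l <= x < r, forall z, l <= z < r -> F z <= F x
                & forall z, l <= z < x -> F z < F x].
Proof.
elim: r => // r IHr; rewrite ltnS leq_eqVlt => /predU1P[<-|lr].
  exists l; split=> [|z|z]; rewrite ?leqnn ?ltnS //; last lia.
  by move=> zl; have -> : z = l by lia.
have [x [lxr xmax xleft]] := IHr lr.
case: (ltnP (F x) (F r)) => xr; [exists r | exists x]; split=> [|z zr|z zr] //; try lia.
- have [zr'|->] : z < r \/ z = r by lia.
    by have := xmax z; lia.
  exact: leqnn.
- by have := xmax z; lia.
- have [zr'|->] : z < r \/ z = r by lia.
    by have := xmax z; lia.
  exact: xr.
- exact: xleft.
Qed.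

(** Valid for every [x]: past the end, the default height 0 continues the path along the axis. *)
Lemma nth_path_step s x : is_path s ->
  nth 0 s x.+1 = if nth 0 s x < nth 0 s x.+1 then (nth 0 s x).+1 else (nth 0 s x).-1.
Proof.
elim: s x => // a [|b s] IHs x; first by move=> /eqP->; case: x => [|x] /=; rewrite ?nth_nil.
by case/and3P => ab ps _; case: x => [|x]; [apply/eqP; rewrite -lattice_stepE | exact: IHs].
Qed.

Lemma nth_path_last s x : is_path s -> size s <= x.+1 -> nth 0 s x = 0.
Proof.
elim: s x => // a [|b s] IHs x; first by move=> /eqP->; case: x => [|x] //=; rewrite nth_nil.
by case/and3P => _ ps _; case: x => // x; exact: IHs.
Qed.

Lemma local_max_peak s x : is_path s -> nth 0 s x.-1 < nth 0 s x ->
  nth 0 s x.+1 <= nth 0 s x -> peak s x.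
Proof.
move=> ps up down; have x0 : 0 < x by rewrite lt0n; apply: contraTneq up => ->; rewrite ltnn.
have xs : x.+1 < size s by rewrite ltnNge; apply/negP => /(nth_path_last ps); lia.
have := nth_path_step x.-1 ps; have := nth_path_step x ps.
by rewrite /peak x0 xs prednK // up ltnNge down /=; lia.
Qed.

(* [x] is the leftmost highest vertex of the excursion of the path above the *)
(* height of the vertex [l]; [r] is where this excursion ends.               *)
Definition crest (s : seq nat) (l x : nat) : Prop :=
  exists r, [/\ l < x < r, nth 0 s r <= nth 0 s l &
    forall z, l < z < r -> [/\ nth 0 s l < nth 0 s z, nth 0 s z <= nth 0 s x &
                              z < x -> nth 0 s z < nth 0 s x]].

Lemma crest_uniq s l x x' : crest s l x -> crest s l x' -> x = x'.
Proof.
move=> [r [lxr rl H]] [r' [lxr' rl' H']].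
have rr' : r = r'.
  case: (ltngtP r r') => // rr'; [have := H' r | have := H r'].
    by case; lia.
  by case; lia.
subst r'; case: (ltngtP x x') => // xx'.
  by have [_ _ /(_ xx')] := H' _ lxr; have [_ + _] := H _ lxr'; lia.
by have [_ _ /(_ xx')] := H _ lxr'; have [_ + _] := H' _ lxr; lia.
Qed.

Lemma crest_peak s l x : is_path s -> crest s l x -> peak s x.
Proof.
move=> ps [r [lxr rl H]]; have [lx _ _] := H x lxr.
apply: local_max_peak => //.
  have [xl|lx1] : x.-1 = l \/ l < x.-1 by lia.
    by rewrite xl.
  by have [_ _ ] := H x.-1 ltac:(lia); apply; lia.
have [->|xr] : x.+1 = r \/ x.+1 < r by lia.
  lia.
by have [] := H x.+1 ltac:(lia).
Qed.

Lemma first_return s l x v : is_path s -> nth 0 s l <= v ->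
    (forall z, l < z <= x -> v < nth 0 s z) -> l < x ->
  exists r, [/\ x < r < size s, nth 0 s r <= v & forall z, l < z < r -> v < nth 0 s z].
Proof.
move=> ps lv H lx.
have xs : x.+1 < size s.
  by rewrite ltnNge; apply/negP => /(nth_path_last ps); have := H x; lia.
have ex : exists r, (x < r) && (nth 0 s r <= v).
  by exists (size s).-1; rewrite nth_path_last //; lia.
case: (ex_minnP ex) => r /andP[xr rv] rmin; exists r; split=> //.
  rewrite xr ltnNge; apply/negP => sr.
  by have := rmin (size s).-1; rewrite nth_path_last //; lia.
move=> z zr; case: (leqP z x) => zx; first by apply: H; lia.
by rewrite ltnNge; apply/negP => zv; have := rmin z; lia.
Qed.

Lemma crest_exists s l : is_path s -> nth 0 s l < nth 0 s l.+1 ->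
  exists x, crest s l x.
Proof.
move=> ps up; have [] := @first_return s l l.+1 (nth 0 s l) ps => //.
  by move=> z zl; have -> : z = l.+1 by lia.
move=> r [lr rl H].
have [x [lx xmax xleft]] := @leftmost_max (nth 0 s) l.+1 r ltac:(lia).
exists x, r; split=> // z zr; split; first exact: H.
  by apply: xmax; lia.
by move=> zx; apply: xleft; lia.
Qed.

Lemma crest_spans s l x : is_path s -> crest s l x ->
  spans s x (nth 0 s x - nth 0 s l).
Proof.
move=> ps [r [lxr rl H]]; have [lx _ _] := H x lxr.
have rs : r < size s.
  rewrite ltnNge; apply/negP => sr.
  have [+ _ _] := H r.-1 ltac:(lia); rewrite (nth_path_last (x := r.-1)) //; lia.
have ls : l < size s by lia.
have rE : nth 0 s r = nth 0 s l.
  have := nth_path_step r.-1 ps; have -> : r.-1.+1 = r by lia.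
  by have [+ _ _] := H r.-1 ltac:(lia); case: ifP; lia.
apply/existsP; exists (Ordinal ls); apply/existsP; exists (Ordinal rs) => /=.
rewrite lxr rE subKn ?eqxx //=; last exact: ltnW.
apply/forallP => z; apply/implyP => /andP[lzr _]; have [_ -> zx] := H z lzr.
apply/implyP => /andP[zNx /eqP zE]; rewrite ltnNge; apply/negP => zlex.
by have := zx ltac:(lia); lia.
Qed.

Lemma spans_relative_height s x : peak s x -> spans s x (relative_height s x).
Proof.
move=> px; have y0 : 1 < (nth 0 s x).+1 by case/and4P: px => _ _ /eqP->.
have card0 : 0 < #|[pred h : 'I_(nth 0 s x).+1 | spans s x h]|.
  by apply/card_gt0P; exists (Ordinal y0); rewrite inE; exact: peak_spans1.
have [h hs hE] := eq_bigmax_cond (fun h : 'I_(nth 0 s x).+1 => h : nat) card0.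
by rewrite /relative_height hE.
Qed.

Lemma relative_height_le s x : relative_height s x <= nth 0 s x.
Proof. by apply/bigmax_leqP => h _; rewrite -ltnS. Qed.

(** Take the last vertex before [x] of height at most [v]. Its excursion lies inside the interval
    witnessing the relative height, where the condition on other peaks forces the crest to be
    [x]. *)
Lemma crest_below s x v : is_path s -> peak s x ->
    nth 0 s x - relative_height s x <= v < nth 0 s x ->
  exists l, [/\ nth 0 s l < nth 0 s l.+1, crest s l x & nth 0 s l = v].
Proof.
move=> ps px vy; have /existsP[l0 /existsP[r0]] := spans_relative_height px.
case/and4P => lxr0 /eqP l0E /eqP r0E /forallP top.
have ex : exists l, (l < x) && (nth 0 s l <= v) by exists l0; lia.
have exb l : (l < x) && (nth 0 s l <= v) -> l <= x by lia.
case: (ex_maxnP ex exb) => l /andP[lx lv] lmax.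
have above z : l < z <= x -> v < nth 0 s z.
  move=> zl; have [->|zx] : z = x \/ z < x by lia.
    by case/andP: vy.
  by rewrite ltnNge; apply/negP => zv; have := lmax z; lia.
have lE : nth 0 s l = v.
  have := above l.+1 ltac:(lia); rewrite (nth_path_step l ps); case: ifP; lia.
exists l; split; first (by rewrite lE; apply: above; lia); last by [].
have [r [xr rv above']] := first_return ps lv above lx.
have rr0 : r <= r0.
  by rewrite leqNgt; apply/negP => rr0; have := above' r0; lia.
have ll0 : l0 <= l by apply: lmax; lia.
have [z [lz zmax zleft]] := @leftmost_max (nth 0 s) l.+1 r ltac:(lia).
have cz : crest s l z.
  exists r; split; [lia | by rewrite lE |] => w wr; split.
  - by rewrite lE; exact: above'.
  - by apply: zmax; lia.
  - by move=> wz; apply: zleft; lia.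
suff <- : z = x by [].
have pz := crest_peak ps cz; have zs : z < size s by case/and4P: pz; lia.
have /implyP := top (Ordinal zs); rewrite /= pz andbT => /(_ ltac:(lia)) /andP[zx /implyP zx'].
have xz : nth 0 s x <= nth 0 s z by apply: zmax; lia.
case: (ltngtP z x) => // [zltx|xltz].
  by have := zx' ltac:(lia); lia.
by have := zleft x; lia.
Qed.

(** Excursions with the same crest are nested, so they start at distinct heights; by [crest_spans]
    and [crest_below] these fill an interval just below the peak. *)
Lemma card_crest s x : is_path s -> peak s x ->
  \sum_(l < size s | (nth 0 s l < nth 0 s l.+1) && `[< crest s l x >]) 1 =
  relative_height s x.
Proof.
move=> ps px.
rewrite -(big_mkord (fun l => (nth 0 s l < nth 0 s l.+1) && `[< crest s l x >]) (fun=> 1)).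
rewrite sum1_count -size_filter -(size_map (nth 0 s)).
rewrite -[RHS](size_iota (nth 0 s x - relative_height s x)).
apply: perm_size; apply: uniq_perm; [|exact: iota_uniq|].
  rewrite map_inj_in_uniq ?filter_uniq ?iota_uniq // => l l'.
  rewrite !mem_filter => /andP[/andP[_ /asboolP[r [lx _ H]]] _].
  move=> /andP[/andP[_ /asboolP[r' [lx' _ H']]] _] ll'.
  case: (ltngtP l l') => // {}lt; first by have [] := H l' ltac:(lia); lia.
  by have [] := H' l ltac:(lia); lia.
have hy := relative_height_le s x.
move=> v; rewrite mem_iota subnK //; apply/mapP/idP => [[l] | vy].
  rewrite mem_filter => /andP[/andP[_ /asboolP cl] _] ->.
  have [r [lx _ /(_ _ lx)[ltlx _ _]]] := cl.
  rewrite ltlx andbT.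
  have hlt : nth 0 s x - nth 0 s l < (nth 0 s x).+1 by lia.
  have := @leq_bigmax_cond _ (fun h : 'I_(nth 0 s x).+1 => spans s x h)
            (fun h => h : nat) (Ordinal hlt) (crest_spans ps cl).
  by rewrite -/(relative_height s x) /=; lia.
have [l [up cl lv]] := crest_below ps px vy.
exists l => //; rewrite mem_filter up mem_index_iota leq0n /=.
apply/andP; split; first exact/asboolP.
rewrite ltnNge; apply/negP => sl; move: up.
by rewrite [nth 0 s l.+1]nth_default //; lia.
Qed.

Lemma ups_path_freq s : is_path s ->
  \sum_(l < size s | nth 0 s l < nth 0 s l.+1) 1 = sumn (path_freq s).
Proof.
elim: s => // a [|b s] IHs ps; first by rewrite big_mkcond big_ord1.
rewrite [path_freq _]/= sumn_burge -/(path_freq (b :: s)) -IHs; last by case/and3P: ps.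
rewrite big_mkcond [in RHS]big_mkcond big_ord_recl addnC /=.
by case: (a < b).
Qed.

Lemma charge_path_freq s : is_path s -> charge s = sumn (path_freq s).
Proof.
move=> ps; rewrite -ups_path_freq //; symmetry.
transitivity (\sum_(l < size s | nth 0 s l < nth 0 s l.+1)
                \sum_(x < size s | `[< crest s l x >]) 1).
  apply: eq_bigr => l /(crest_exists ps)[x cx].
  have xs : x < size s by case/and4P: (crest_peak ps cx); lia.
  rewrite (big_pred1 (Ordinal xs)) // => z; apply/asboolP/eqP => [cz|->] //.
  by apply: val_inj; exact: crest_uniq cz cx.
rewrite (exchange_big_dep (fun x : 'I_(size s) => peak s x)) /=; last first.
  by move=> l x _ /asboolP; exact: crest_peak.
by apply: eq_bigr => x; exact: card_crest.
Qed.

(** The leftmost highest vertex is the start or a peak. *)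
Lemma all_le_path M s : is_path s -> nth 0 s 0 <= M ->
  (forall x, peak s x -> nth 0 s x <= M) -> all (leq^~ M) s.
Proof.
move=> ps s0 H; apply/(all_nthP 0) => x xs; rewrite leqNgt; apply/negP => Mx.
have [z [zs zmax zleft]] := @leftmost_max (nth 0 s) 0 (size s) ltac:(lia).
have Mz : M < nth 0 s z by apply: leq_trans Mx (zmax _ _).
suff pz : peak s z by have := H z pz; lia.
have z0 : 0 < z by case: z Mz {zs zmax zleft} => //; lia.
apply: local_max_peak => //; [by apply: zleft; lia|].
by case: (ltnP z.+1 (size s)) => zs1; [apply: zmax | rewrite nth_default]; lia.
Qed.

(** * From jagged partitions to frequency sequences *)

Fixpoint is_jagged (s : seq nat) : bool :=
  if s is x :: t then
    [&& nth 0 t 0 <= x.+1, nth 0 t 1 <= x, (t == [::]) ==> (0 < x) & is_jagged t]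
  else true.

Lemma is_jaggedP s : jagged s <-> is_jagged s.
Proof.
elim: s => [|x s IHs]; first by split=> // _; split.
split=> [[H1 H2 H3]|/= /and4P[s0 s1 /implyP x0 /IHs[H1 H2 H3]]].
  apply/and4P; split.
  - by case: s H1 {IHs H2 H3} => //= y s /(_ 0); apply.
  - by case: s H2 {IHs H1 H3} => [|y [|z s]] //= /(_ 0); apply.
  - by apply/implyP => /eqP sE; move: H3; rewrite sE; apply.
  - apply/IHs; split=> [j js|j js|].
    + exact: (H1 j.+1).
    + exact: (H2 j.+1).
    + by case: s H3 {IHs H1 H2} => //= y s H3 _; apply: H3.
split=> [[|j] js|[|j] js|_].
- by case: s s0 {IHs s1 x0 H1 H2 H3 js}.
- exact: H1.
- by [].
- exact: H2.
- by case: s x0 H3 {IHs s0 s1 H1 H2} => [|y s] /= x0 H3; [exact: x0 | exact: H3].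
Qed.

(* A pair [r, r+1] becomes two parts [2r+1], any other entry [r] a part [2r]. *)
Fixpoint parts (s : seq nat) : seq nat :=
  match s with
  | x :: (y :: s') as t => if y == x.+1 then [:: x + y, x + y & parts s'] else x.*2 :: parts t
  | [:: x] => [:: x.*2]
  | [::] => [::]
  end.

Lemma parts_pair x s : parts [:: x, x.+1 & s] = [:: x.*2.+1, x.*2.+1 & parts s].
Proof. by rewrite /= eqxx addnS addnn. Qed.

Lemma parts_single x s : (nth 0 s 0 == x.+1) = false -> parts (x :: s) = x.*2 :: parts s.
Proof. by case: s => //= y s ->. Qed.

Lemma parts_ind (P : seq nat -> Prop) : P [::] ->
    (forall x s, P s -> P [:: x, x.+1 & s]) ->
    (forall x s, (nth 0 s 0 == x.+1) = false -> P s -> P (x :: s)) ->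
  forall s, P s.
Proof.
move=> P0 P2 P1 s; have [n] := ubnP (size s); elim: n s => // n IHn [//|x s] /= sn.
case sx: (nth 0 s 0 == x.+1); last by apply: P1 => //; exact: IHn.
by case: s sx sn => //= y s /eqP-> sn; apply: P2; apply: IHn; lia.
Qed.

Lemma size_parts s : size (parts s) = size s.
Proof.
by elim/parts_ind: s => // [x s|x s sx] IHs; rewrite ?parts_pair ?parts_single //= IHs.
Qed.

Lemma sumn_parts s : sumn (parts s) = (sumn s).*2.
Proof.
by elim/parts_ind: s => // [x s|x s sx] IHs; rewrite ?parts_pair ?parts_single //= IHs; lia.
Qed.

Lemma even_count_parts s j : odd j -> ~~ odd (count_mem j (parts s)).
Proof.
move=> oj; elim/parts_ind: s => // [x s|x s sx] IHs.
  by rewrite parts_pair /=; case: (_ == j); rewrite /= ?negbK.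
rewrite parts_single //= oddD (negbTE IHs) addbF.
by case: eqP => // jx; move: oj; rewrite -jx odd_double.
Qed.

Lemma parts_inj : injective parts.
Proof.
move=> s; elim/parts_ind: s => [|x s IHs|x s sx IHs] t; elim/parts_ind: t => [|y t _|y t ty _] //;
  rewrite ?parts_pair ?parts_single // => -[].
- by move=> xy _ /IHs->; have -> : x = y by lia.
- by lia.
- by lia.
- by move=> xy /IHs->; have -> : x = y by lia.
Qed.

Lemma pairs01_cons x s :
  pairs01 (x :: s) = ((x == 0) && (nth 0 s 0 == 1)) + pairs01 s.
Proof.
rewrite /pairs01 -!sum1dep_card !(big_mkcond (fun _ => _ && _)) big_ord_recl /=.
congr (_ + _).
by case: s => [|y s] /=; rewrite ?andbF //; case: (_ && _).
Qed.

Lemma pairs01_parts s : (pairs01 s).*2 = count_mem 1 (parts s).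
Proof.
elim/parts_ind: s => [|x s IHs|x s sx IHs].
- by rewrite /pairs01 -sum1dep_card big_mkcond big_ord0.
- rewrite !pairs01_cons parts_pair /= -IHs.
  by case: x => [|x] //=; lia.
- rewrite pairs01_cons parts_single //= -IHs.
  by case: x sx => [|x] //= ->.
Qed.

Lemma head_parts s : is_jagged s ->
  (nth 0 s 0 = (nth 0 (parts s) 0)./2) * (nth 0 s 1 <= uphalf (nth 0 (parts s) 0)).
Proof.
elim/parts_ind: s => // [x s IHs|x s sx IHs]; rewrite ?parts_pair ?parts_single //=.
  by move=> _; split; lia.
by case/and4P => s0 s1 _ _; split; lia.
Qed.

Lemma sorted_cons x s : sorted geq (x :: s) = (nth 0 s 0 <= x) && sorted geq s.
Proof. by case: s. Qed.

Lemma sorted_parts s : is_jagged s -> sorted geq (parts s) && all (leq 1) (parts s).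
Proof.
elim/parts_ind: s => // [x s IHs|x s sx IHs];
  rewrite [is_jagged _]/= ?parts_pair ?parts_single // !sorted_cons /=.
  case/and3P => _ s0 /and4P[_ s1 _ js]; rewrite leqnn.
  have [h0 h1] := head_parts js; case/andP: (IHs js) => -> ->; rewrite !andbT /=.
  move: s0 s1 h0 h1; rewrite uphalf_half; lia.
case/and4P => s0 s1 /implyP x0 js; have [h0 h1] := head_parts js.
case/andP: (IHs js) => so al; rewrite so al !andbT.
have hd : nth 0 (parts s) 0 <= x.*2.
  (* An odd head comes from a pair [(y, y+1)], and [y + 1 <= x] since these entries are two places
     apart. *)
  have [od|ev] := boolP (odd (nth 0 (parts s) 0)); last by lia.
  case: s {IHs so al x0} js sx s0 s1 h0 h1 od => // y s js sx s0 s1 h0 h1.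
  case sy: (nth 0 s 0 == y.+1); last by rewrite parts_single //= odd_double.
  by case: s sy {js sx} s0 s1 h0 h1 => //= z s sy; rewrite sy /=; lia.
rewrite hd /=.
case: s {IHs so} al x0 hd js {h0 h1 s0 s1 sx} => [_ /(_ isT)|y s al _ hd _]; first lia.
have : 1 <= nth 0 (parts (y :: s)) 0 by apply: (all_nthP 0 al); rewrite size_parts.
lia.
Qed.

(** An odd largest part has even multiplicity, so it occurs twice and is read back as a pair. *)
Lemma parts_surj l : sorted geq l -> all (leq 1) l ->
    (forall j, odd j -> ~~ odd (count_mem j l)) ->
  exists2 s, is_jagged s & parts s = l.
Proof.
have [n] := ubnP (size l); elim: n l => // n IHn [|a l] /= sn; first by exists [::].
rewrite -/(sorted geq (a :: l)) sorted_cons => /andP[la sl] /andP[a0 l1] ev.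
have [oa|ea] := boolP (odd a); last first.
  have [//|//|//|j oj|s js sE] := IHn l.
    have := ev j oj; case: eqP => // aj; by rewrite aj oj in ea.
  have [h0 h1] := head_parts js; rewrite sE uphalf_half in h0 h1.
  exists (a./2 :: s).
    by rewrite /= js andbT; apply/and3P; split; lia.
  rewrite parts_single ?sE; first by congr (_ :: _); lia.
  by apply/negbTE; lia.
have [l' lE] : exists l', l = a :: l'.
  case: l la sl l1 ev {sn} => [_ _ _ /(_ a oa)|b l /= ba sl l1 ev]; first by rewrite eqxx.
  exists l; congr (_ :: _); apply/eqP; rewrite eqn_leq ba leqNgt; apply/negP => ab.
  have al : count_mem a l = 0.
    apply/count_memPn/negP => al.
    by have := order_path_min (rev_trans leq_trans) sl => /allP/(_ a al) /=; lia.
  by have := ev a oa; rewrite eqxx al (_ : (b == a) = false) //; lia.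
move: la sl l1 ev sn; rewrite lE sorted_cons /= => _ /andP[la sl] /andP[_ l1] ev sn.
have [|//|j oj|s js sE] := IHn l' _ sl; first by lia.
  by have := ev j oj; case: (a == j); rewrite /= ?negbK.
have [h0 h1] := head_parts js; rewrite sE uphalf_half in h0 h1.
exists [:: a./2, a./2.+1 & s].
  by rewrite /= js andbT implybT /=; lia.
rewrite parts_pair sE; have -> : a./2.*2.+1 = a by lia.
by [].
Qed.

Lemma nth_parts s p : p < size s ->
  [\/ nth 0 (parts s) p = (nth 0 s p).*2,
      [/\ p.+1 < size s, nth 0 s p.+1 = (nth 0 s p).+1,
          nth 0 (parts s) p = (nth 0 s p).*2.+1 & nth 0 (parts s) p.+1 = (nth 0 s p).*2.+1] |
      [/\ 0 < p, nth 0 s p = (nth 0 s p.-1).+1,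
          nth 0 (parts s) p = (nth 0 s p.-1).*2.+1 & nth 0 (parts s) p.-1 = (nth 0 s p.-1).*2.+1]].
Proof.
elim/parts_ind: s p => // [x s IHs|x s sx IHs] p; rewrite ?parts_pair ?parts_single //.
  case: p => [|[|p]] /= ps; [by constructor 2 | by constructor 3 |].
  case: (IHs p); [lia | by constructor 1 | by case=> ? ? ? ?; constructor 2 |].
  by case: p {ps} => [|p] [//] ? ? ? ?; constructor 3.
case: p => [|p] /= ps; first by constructor 1.
case: (IHs p); [lia | by constructor 1 | by case=> ? ? ? ?; constructor 2 |].
by case: p {ps} => [|p] [//] ? ? ? ?; constructor 3.
Qed.

Lemma sorted_nth_geq l p q : sorted geq l -> p <= q -> nth 0 l q <= nth 0 l p.
Proof.
move=> sl pq; case: (ltnP q (size l)) => ql; last by rewrite nth_default.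
have := sorted_leq_nth (rev_trans leq_trans) leqnn 0 sl.
by move=> /(_ p q); rewrite !inE; apply=> //; exact: leq_ltn_trans ql.
Qed.

Lemma nth_parts_bounds s p : p < size s ->
  (nth 0 (parts s) p)./2 <= nth 0 s p <= uphalf (nth 0 (parts s) p).
Proof. by move=> /nth_parts[|[]|[]] *; lia. Qed.

(** The exceptional alternative is the case where [p] opens a pair and [p + (K - 1)] closes the next
    lower one: the entries agree but the parts differ by 2. Conversely, a difference below 2
    violates the restriction at [p], at [p - 1] if [p] closes a pair, or at [p + 1] if [p] is
    unpaired and [p + (K - 1)] opens a pair. *)
Lemma restricted_parts K s : 2 < K -> is_jagged s ->
  restricted K s <-> forall p, p + (K - 1) < size s ->
    nth 0 (parts s) (p + (K - 1)) + 2 <= nth 0 (parts s) p.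
Proof.
move=> K2 js; have /andP[sp _] := sorted_parts js.
have mono p q : p <= q -> nth 0 (parts s) q <= nth 0 (parts s) p by exact: sorted_nth_geq.
have bnd := @nth_parts_bounds s.
split=> [R|C] p ps; (have psp : p < size s by lia); last first.
  have Cp := C p ps; have bK := bnd _ ps.
  case: (nth_parts psp) => [cE|[_ nE cE _]|[p0 nE cE _]]; [by lia| |by lia].
  case: (nth_parts ps) => [|[]|[]]; [by lia..|move=> pK0 nE' cE' _].
  have pE : (p + (K - 1)).-1 = p + (K - 2) by lia.
  rewrite pE in nE' cE'.
  by case: (ltnP (nth 0 s (p + (K - 1))) (nth 0 s p)) => h; [left | right; split]; lia.
rewrite leqNgt; apply/negP => bad.
case: (nth_parts psp) => [cE|[ps1 nE cE cE1]|[p0 nE cE cE1]].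
- have b1 := bnd p.+1 ltac:(lia); have m1 := mono p p.+1 ltac:(lia).
  have full : nth 0 s (p + (K - 1)) <> nth 0 s p.
    by case: (R p ps) => [|[]]; lia.
  case: (nth_parts ps) => [|[psK nE' cE' _]|[]]; [|have m2 := mono p p.+2 ltac:(lia)|].
  + by have := mono p (p + (K - 1)) ltac:(lia); lia.
  + have b2 := bnd p.+2 ltac:(lia).
    have := mono p (p + (K - 1)) ltac:(lia).
    have := R p.+1 ltac:(lia); rewrite addSn.
    by case=> [|[]]; lia.
  + by have := mono p (p + (K - 1)) ltac:(lia); lia.
- have bK := bnd _ ps; have bK' := bnd (p + (K - 2)) ltac:(lia).
  have mK := mono (p + (K - 2)) (p + (K - 1)) ltac:(lia).
  by case: (R p ps) => [|[]]; lia.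
- have qE : p.-1 + (K - 1) = p + (K - 2) by lia.
  have bK := bnd (p + (K - 2)) ltac:(lia); have bK' := bnd (p.-1 + (K - 2)) ltac:(lia).
  have mK := mono (p + (K - 2)) (p + (K - 1)) ltac:(lia).
  have mK' := mono (p.-1 + (K - 2)) (p + (K - 2)) ltac:(lia).
  by have := R p.-1 ltac:(lia); rewrite qE; case=> [|[]]; lia.
Qed.

(** * Partitions and their multiplicities *)

Definition multiplicities (l : seq nat) : seq nat :=
  mkseq (fun j => count_mem j.+1 l) (nth 0 l 0).

Fixpoint parts_of_freq (k : nat) (f : seq nat) : seq nat :=
  if f is a :: g then nseq a k ++ parts_of_freq k.+1 g else [::].

Lemma sorted_geq_le_head l x : sorted geq l -> x \in l -> x <= nth 0 l 0.
Proof.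
by move=> sl /(nthP 0)[p _ <-]; exact: sorted_nth_geq.
Qed.

Lemma nth_multiplicities l j : sorted geq l ->
  nth 0 (multiplicities l) j = count_mem j.+1 l.
Proof.
move=> sl; case: (ltnP j (nth 0 l 0)) => jl; first by rewrite nth_mkseq.
rewrite nth_default ?size_mkseq //; apply/esym/count_memPn/negP.
by move=> /(sorted_geq_le_head sl); lia.
Qed.

Lemma trimmed_multiplicities l : sorted geq l -> all (leq 1) l ->
  trimmed (multiplicities l).
Proof.
case: l => // -[|a] l // sl _.
rewrite /trimmed -nth_last size_mkseq nth_mkseq //= eqxx; exact: lt0n_neq0.
Qed.

Lemma count_parts_of_freq k f j :
  count_mem j (parts_of_freq k f) = if j < k then 0 else nth 0 f (j - k).
Proof.
elim: f k => [|a f IHf] k /=; first by rewrite nth_nil if_same.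
rewrite count_cat count_nseq IHf /= eq_sym.
case: (ltngtP j k) => jk.
- by rewrite ltnS ltnW.
- by rewrite ltnS leqNgt jk /= mul0n; have -> : j - k = (j - k.+1).+1 by lia.
- by rewrite jk ltnSn subnn mul1n addn0.
Qed.

Lemma size_parts_of_freq k f : size (parts_of_freq k f) = sumn f.
Proof. by elim: f k => //= a f IHf k; rewrite size_cat size_nseq IHf. Qed.

Lemma sumn_parts_of_freq k f :
  sumn (parts_of_freq k.+1 f) = freq_weight f + k * sumn f.
Proof.
elim: f k => [|a f IHf] k /=; first by rewrite muln0.
by rewrite sumn_cat sumn_nseq IHf; lia.
Qed.

Lemma perm_parts_of_multiplicities l : sorted geq l -> all (leq 1) l ->
  perm_eq (parts_of_freq 1 (multiplicities l)) l.
Proof.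
move=> sl l1; apply/allP => j _ /=; rewrite count_parts_of_freq nth_multiplicities //.
case: j => [|j] /=; last by rewrite subn1.
apply/eqP/esym/count_memPn/negP => /(allP l1); by [].
Qed.

Lemma trimmed_eq f g : trimmed f -> trimmed g -> nth 0 f =1 nth 0 g -> f = g.
Proof.
wlog fg : f g / size f <= size g => [H tf tg E|tf tg E].
  by case: (leqP (size f) (size g)) => [|/ltnW] fg; [|symmetry]; apply: H.
apply: (@eq_from_nth _ 0) => //.
apply/eqP; rewrite eqn_leq fg leqNgt; apply/negP => gf.
case: g gf tg E {fg} => // b g gf tg E; move: tg.
by rewrite /trimmed /= (last_nth 0) -E nth_default.
Qed.

Lemma multiplicities_inj l l' : sorted geq l -> sorted geq l' ->
  all (leq 1) l -> all (leq 1) l' -> multiplicities l = multiplicities l' -> l = l'.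
Proof.
move=> sl sl' l1 l1' E.
apply: (sorted_eq (rev_trans leq_trans) _ sl sl') => [x y xy|].
  by apply/eqP; rewrite eqn_leq andbC.
apply: perm_trans (perm_parts_of_multiplicities sl' l1'); rewrite -E perm_sym.
exact: perm_parts_of_multiplicities.
Qed.

Lemma multiplicities_surj f : trimmed f ->
  exists l, [/\ sorted geq l, all (leq 1) l & multiplicities l = f].
Proof.
move=> tf; pose l := sort geq (parts_of_freq 1 f).
have pl : perm_eq l (parts_of_freq 1 f) by rewrite /l perm_sort.
have sl : sorted geq l by apply: sort_sorted => x y; exact: leq_total.
have l1 : all (leq 1) l.
  rewrite (perm_all _ pl); apply/allP => -[|//]; rewrite -has_pred1 has_count.
  by rewrite count_parts_of_freq.
exists l; split=> //; apply: trimmed_eq tf _; first exact: trimmed_multiplicities.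
move=> j; rewrite nth_multiplicities // (permP pl) count_parts_of_freq.
by rewrite ltnS ltn0 subn1.
Qed.

(** The counts form the conjugate partition. *)
Lemma sorted_geq_count l j p : sorted geq l -> p < size l ->
  (j <= nth 0 l p) = (p < count (leq j) l).
Proof.
elim: l p => // a l IHl p; rewrite sorted_cons => /andP[al sl].
have count0 : a < j -> count (leq j) l = 0.
  move=> aj; apply/eqP; rewrite -leqn0 leqNgt -has_count; apply/hasPn => x xl.
  by have := sorted_geq_le_head sl xl; lia.
case: p => [|p] /= ps.
  by case: (leqP j a) => // /count0->.
rewrite IHl //; case: (leqP j a) => // /count0->; by [].
Qed.

(** Parts equal to [j] or [j+1] are consecutive in [l]; there are more than [M] of them for some [j]
    exactly when two parts [M] places apart differ by at most 1. *)
Lemma parts_difference M l : sorted geq l ->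
  (forall p, p + M < size l -> nth 0 l (p + M) + 2 <= nth 0 l p) <->
  (forall j, count_mem j l + count_mem j.+1 l <= M).
Proof.
move=> sl; have split_count j :
    count (leq j) l = count_mem j l + count_mem j.+1 l + count (leq j.+2) l.
  by elim: l {sl} => //= a l ->; lia.
split=> [H j|H p ps].
  have [//|M1] := leqP (count_mem j l + count_mem j.+1 l) M.
  set p := count (leq j.+2) l.
  have ps : p + M < count (leq j) l by rewrite split_count -/p; lia.
  have psl := leq_trans ps (count_size _ _).
  have := H p psl; have := sorted_geq_count j sl psl; rewrite ps.
  by have := @sorted_geq_count l j.+2 p sl ltac:(lia); rewrite ltnn; lia.
rewrite leqNgt; apply/negP => bad; set j := nth 0 l (p + M) in bad.
have := H j; have := split_count j.
have := sorted_geq_count j sl ps; rewrite leqnn => /esym.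
by have := @sorted_geq_count l j.+2 p sl ltac:(lia); lia.
Qed.

(** * Both sides as the same set of frequency sequences *)

Definition freq_set (a M w m : nat) : set (seq nat) :=
  [set f | [/\ trimmed f, alternate_even true f & adjacent_le M (a :: f)] /\
           (freq_weight f = w /\ sumn f = m)]%classic.

Lemma ncard_image (T U : choiceType) (f : T -> U) (A : set T) (B : set U) :
  finite_set A -> {in A &, injective f} -> (f @` A)%classic = B ->
  ncard A = ncard B.
Proof.
move=> finA injf <-; rewrite /ncard fset_set_image // card_in_imfset // => x y.
by rewrite !in_fset_set // => xA yA; exact: injf.
Qed.

Lemma image_path_freq K kappa i w m : 2 * kappa - 2 * i <= K - 1 ->
  (path_freq @` path_set K kappa i w m)%classic =
  freq_set (2 * kappa - 2 * i) (K - 1) w m.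
Proof.
move=> aK; apply/seteqP; split=> [_ [s [[/is_pathP[_ ps] s0 sw sc] pk] <-] | f].
  have peaks x : peak s x -> nth 0 s x <= K - 1 by move=> /pk[].
  have peaks_even : forall x, peak s x -> ~~ odd x by move=> x /pk[].
  split; last by rewrite -weight_path_freq // -charge_path_freq.
  split; [exact: trimmed_path_freq | exact/even_peaks_path_freq |].
  case: s s0 ps peaks {sw sc pk peaks_even} => // a s a0 ps peaks; rewrite /= in a0.
  by rewrite -a0 (adjacent_le_path_freq _ ps); apply: all_le_path; rewrite //= a0.
move=> [[tf ef af] [fw fm]].
have [s [ps s0 sf]] := path_freq_surj (2 * kappa - 2 * i) tf.
exists s => //; split; first split.
- by apply/is_pathP; rewrite s0; split=> //; rewrite -mulnBr oddM.
- by [].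
- by rewrite weight_path_freq // sf.
- by rewrite charge_path_freq // sf.
rewrite -sf in ef af.
move=> x px; split; last exact: (proj2 (even_peaks_path_freq ps) ef).
case: s ps s0 af px {sf ef} => // a s ps a0; rewrite /= in a0.
rewrite -a0 (adjacent_le_path_freq _ ps).
by move=> /(all_nthP 0) H px; apply: H; case/and4P: px => _ /ltnW.
Qed.

Lemma restricted_freq K kappa i eps s (f := multiplicities (parts s)) :
    2 < K -> 0 < i <= kappa -> eps <= 1 -> K = 2 * kappa - eps -> is_jagged s ->
  restricted K s /\ pairs01 s <= i - 1 <->
  adjacent_le (K - 1) (2 * kappa - 2 * i :: f).
Proof.
move=> K2 ik e1 KE js; have /andP[sp _] := sorted_parts js.
rewrite restricted_parts // -(size_parts s) (parts_difference _ sp).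
have f0 : nth 0 f 0 = (pairs01 s).*2 by rewrite nth_multiplicities // pairs01_parts.
(* Since [f_1] is even, the bound comes out as [i - 1] for both values of [eps]. *)
have H0 : pairs01 s <= i - 1 <-> 2 * kappa - 2 * i + nth 0 f 0 <= K - 1.
  by rewrite f0; split; lia.
split=> [[H /H0 p01] | /adjacent_leP H].
  by apply/adjacent_leP => -[|j] //=; rewrite !nth_multiplicities.
split; last exact/H0/(H 0).
move=> [|j]; last by have := H j.+1; rewrite /= !nth_multiplicities.
have -> : count_mem 0 (parts s) = 0.
  by apply/count_memPn/negP => /(allP (proj2 (andP (sorted_parts js)))).
by have := H 0; rewrite /= nth_multiplicities //; apply: leq_trans; rewrite add0n leq_addl.
Qed.

Lemma image_multiplicities K kappa i eps n m :
    2 < K -> 0 < i <= kappa -> eps <= 1 -> K = 2 * kappa - eps ->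
  ((multiplicities \o parts) @` jagged_set K i n m)%classic =
  freq_set (2 * kappa - 2 * i) (K - 1) (2 * n) m.
Proof.
move=> K2 ik e1 KE.
have totals s : is_jagged s -> freq_weight (multiplicities (parts s)) = 2 * sumn s /\
    sumn (multiplicities (parts s)) = size s.
  move=> js; have /andP[sp p1] := sorted_parts js.
  have pm := perm_parts_of_multiplicities sp p1.
  rewrite -(size_parts s) -(perm_size pm) size_parts_of_freq mul2n -sumn_parts.
  by rewrite -(perm_sumn pm) sumn_parts_of_freq mul0n addn0.
apply/seteqP; split=> [_ [s [[/is_jaggedP js sm sn] rs] <-] | f].
  have /andP[sp p1] := sorted_parts js.
  have [w c] := totals s js; rewrite sm sn in w c; split=> //=; split.
  - exact: trimmed_multiplicities.
  - apply/alternate_evenP => j oj; rewrite nth_multiplicities //.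
    by apply: even_count_parts; move: oj => /=; case: (odd j).
  - exact/(restricted_freq K2 ik e1 KE js).
move=> [[tf ef af] [fw fm]].
have [l [sl l1 lf]] := multiplicities_surj tf.
have [|s js sl'] := parts_surj sl l1.
  move=> [//|j] oj; rewrite -nth_multiplicities // lf.
  by apply: (alternate_evenP _ _ ef); move: oj => /=; case: (odd j).
have [w c] := totals s js; rewrite sl' lf in w c.
exists s; last by rewrite /= sl'.
split; first by split; [exact/is_jaggedP | rewrite -c | lia].
by apply/(restricted_freq K2 ik e1 KE js); rewrite sl' lf.
Qed.

Unset Implicit Arguments.

Theorem theorem1 (K i kappa eps : nat) (hK : 2 < K) (hi : 0 < i)
    (hkappa : 0 < kappa) (heps : eps = 0 \/ eps = 1)
    (hKkappa : K = 2 * kappa - eps) (hikappa : i <= kappa) (n m : nat) :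
  jagged_number K i n m = path_number K kappa i (2 * n) m.
Proof.
have ik : 0 < i <= kappa by rewrite hi.
have e1 : eps <= 1 by lia.
transitivity (ncard (freq_set (2 * kappa - 2 * i) (K - 1) (2 * n) m)).
  apply: ncard_image (image_multiplicities n m hK ik e1 hKkappa) => [|s t].
    exact: jagged_set_finite.
  rewrite !inE => -[[/is_jaggedP js _ _] _] [[/is_jaggedP jt _ _] _] st.
  have /andP[? ?] := sorted_parts js; have /andP[? ?] := sorted_parts jt.
  by apply: parts_inj; exact: multiplicities_inj.
have aK : 2 * kappa - 2 * i <= K - 1 by lia.
apply/esym; apply: ncard_image (image_path_freq _ _ aK) => [|s t].
  exact: path_set_finite.
rewrite !inE => -[[/is_pathP[_ ps] s0 _ _] _] [[/is_pathP[_ pt] t0 _ _] _].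
by apply: path_freq_inj; rewrite // s0.
Qed.
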